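(* Let $X$ be a random variable taking values in a real interval $I$, with probability density function $f$. Let $u$ be a $C^1$ increasing function $I\longrightarrow\mathbb{R}$, such that $\frac{f}{u'}: x\longmapsto \frac{f(x)}{u'(x)}$ conforms to the following: there exists $a>0$ such that (1) $\max\left(\frac{f}{u'}\right)=m=\frac{f}{u'}(a)$, and (2) $\frac{f}{u'}$ is non-decreasing on $]0,a]$, and non-increasing on $[a,+\infty[\,\cap I$. Then, for all $z\in[0,1[$, $$\left\vert P\left(\{u(X)\}<z\right)-z\right\vert<2m.$$ In particular, if $(X_n)$ is a sequence of such random variables with probability density functions $f_n$ and $\max(f_n/u')=m_n$, and $\lim_{n\to+\infty} m_n=0$, then $\{u(X_n)\}$ converges in law toward the uniform distribution $U([0,1[)$ when $n\longrightarrow\infty$.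
   Context: For a real number $x$, $\lfloor x\rfloor$ denotes the greatest integer not exceeding $x$, and $\{x\}=x-\lfloor x\rfloor$. $u'$ denotes the derivative of $u$. Intervals are written in the notation $]a,b]=(a,b]$, $[a,b[\,=[a,b)$, etc. $U([0,1[)$ is the uniform probability distribution on $[0,1[$.
   Formalization: If I contains negative numbers, f/u' is also assumed non-decreasing on the negative part of I, with values there at most those at later points up to a; without this the claim fails, e.g. u=id, I=]-N,1/2], f constant on points with fractional part ≤1/2 and zero elsewhere, z=1/2, N large. *)

(* Defs.v *)
From HB Require Import structures.
From mathcomp Require Import all_boot all_order all_algebra.
From mathcomp Require Import all_classical all_reals all_analysis.
Set Implicit Arguments.
Unset Strict Implicit.
Unset Printing Implicit Defensive.
Import Order.TTheory GRing.Theory Num.Theory.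
Import numFieldNormedType.Exports.
Local Open Scope classical_set_scope.
Local Open Scope ring_scope.

Definition fracpart (R : realType) (x : R) : R := x - (Num.floor x)%:~R.

Definition diff_quotient (R : realType) (u : R -> R) (x y : R) : R :=
  (u y - u x) / (y - x).

(* The increments stay in I, so that the derivative is one-sided at an
   endpoint of I and the values of u outside I are irrelevant. *)
Definition derive_in (R : realType) (I : interval R) (u : R -> R) (x : R) : R :=
  lim (diff_quotient u x @ within [set` I] x^').

Definition C1_on (R : realType) (I : interval R) (u : R -> R) : Prop :=
  {in I, forall x, cvg (diff_quotient u x @ within [set` I] x^')} /\
  {within [set` I], continuous (derive_in I u)}.

(* Only the values of f on I matter. *)
Definition has_density_on (R : realType) (d : measure_display)
    (T : measurableType d) (P : probability T R) (X : {RV P >-> R})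
    (I : interval R) (f : R -> R) : Prop :=
  [/\ measurable_fun [set` I] f,
      {in I, forall x, 0 <= f x} &
      forall A : set R, measurable A ->
        distribution P X A =
          (\int[@lebesgue_measure R]_(x in A `&` [set` I]) (f x)%:E)%E].

(* The clause on x < 0 is void when I is contained in [0, +oo[. Without it the
   part of I to the left of 0 would be unconstrained except for g <= m, and a
   density could concentrate there on the points with a prescribed fractional
   part: take u = id, I = ]-N, 1/2], and f constant on the points of I whose
   fractional part is at most 1/2 and zero elsewhere. *)
Definition unimodal_with_max (R : realType) (I : interval R) (g : R -> R)
    (m : R) : Prop :=
  exists a : R,
    [/\ 0 < a /\ a \in I,
        g a = m /\ {in I, forall x, g x <= m},
        {in I &, forall x y, 0 < x -> x <= y -> y <= a -> g x <= g y},
        {in I &, forall x y, x < 0 -> x <= y -> y <= a -> g x <= g y} &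
        {in I &, forall x y, a <= x -> x <= y -> g y <= g x}].

(* Convergence in law of real random variables, by convergence of the
   distribution functions at every continuity point of the limit one. *)
Definition cvg_in_law (R : realType) (d : nat -> measure_display)
    (T : forall n, measurableType (d n)) (P : forall n, probability (T n) R)
    (Y : forall n, T n -> R) (mu : set R -> \bar R) : Prop :=
  (forall n, measurable_fun [set: T n] (Y n)) /\
  forall x : R, {for x, continuous (fun r : R => mu `]-oo, r]%classic)} ->
    P n (Y n @^-1` `]-oo, x]%classic) @[n --> \oo] --> mu `]-oo, x]%classic.

(* The endpoint 1 has measure 0, so this is also the uniform law on [0, 1[. *)
Definition uniform01 (R : realType) : set R -> \bar R :=
  uniform_prob (@ltr01 R).

(* Main.v *)
Require Import Defs.
From HB Require Import structures.
From mathcomp Require Import all_boot all_order all_algebra.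
From mathcomp Require Import all_classical all_reals all_analysis.
From mathcomp Require Import measurable_realfun lra.
Set Implicit Arguments.
Unset Strict Implicit.
Unset Printing Implicit Defensive.
Import Order.TTheory GRing.Theory Num.Theory.
Import numFieldNormedType.Exports.
Local Open Scope classical_set_scope.
Local Open Scope ring_scope.

(* Write v = u', g = f / v and nu(A) = \int_A v, so that u carries nu to the
   Lebesgue measure. By the layer cake formula P(X \in A) is the integral over
   t in [0, m] of nu(A `&` {g > t}), and each superlevel set {g > t} is, up to
   the point 0, an interval S. An interval carried by u onto an interval of
   length l = nu(S) contains at least l - 2 full cells [k, k + 1[, hence
   nu(S `&` {a <= {u} < b}) >= (b - a)(l - 2). Integrating over t gives
   P(a <= {u(X)} < b) >= (b - a)(1 - 2m); the cases (a, b) = (0, z) and (z, 1)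
   are the lower and the upper bound on P({u(X)} < z). *)

(** * Convexity and punctured neighbourhoods in a real interval *)

Lemma itv_convex (R : realType) (I : interval R) (x y z : R) :
  x \in I -> y \in I -> x <= z -> z <= y -> z \in I.
Proof.
move=> xI yI xz zy.
by apply: (@interval_is_interval _ I x y) => //; rewrite xz.
Qed.

(** Makes limits of difference quotients at [x] meaningful: a second point [y] of [I] supplies
    points of [I] other than [x] arbitrarily close to [x]. For a one-point [I] the filter would be
    degenerate. *)
Lemma within_dnbhs_itv_proper (R : realType) (I : interval R) (x y : R) :
  x \in I -> y \in I -> x != y -> ProperFilter (within [set` I] x^').
Proof.
move=> xI yI xy; apply: Build_ProperFilter_ex => P.
rewrite /within/= => -[e /= e0 eP].
(* With this [s] the step from [x] towards [y] has length min(e / 2, |y - x|): it is shorter than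
   [e] and does not pass [y]. *)
pose s := Num.min (e / 2) (`|y - x|) / `|y - x|.
have d0 : 0 < `|y - x| by rewrite normr_gt0 subr_eq0 eq_sym.
have m0 : 0 < Num.min (e / 2) (`|y - x|) by rewrite lt_min d0 divr_gt0.
have s0 : 0 < s by rewrite divr_gt0.
have s1 : s <= 1 by rewrite ler_pdivrMr// mul1r ge_min lexx orbT.
exists (x + s * (y - x)); apply: eP.
- rewrite /ball/= opprD addNKr normrN normrM (gtr0_norm s0) /s -mulrA mulVf ?gt_eqF//.
  by rewrite mulr1 gt_min ltr_pdivrMr// ltr_pMr// ltr1n.
- by rewrite -subr_eq0 addrC addKr mulf_eq0 negb_or gt_eqF//= subr_eq0 eq_sym.
- have [xy'|yx] := ltP x y.
    by apply: (itv_convex xI yI); nra.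
  by apply: (itv_convex yI xI); nra.
Qed.

(** * The derivative relative to an interval and the fundamental theorem of calculus *)

Section derivative_on_interval.
Context (R : realType) (I : interval R) (u : R -> R).
Hypotheses (hC1 : C1_on I u) (hincr : {in I &, {homo u : x y / x < y}}).

(** Off [x], [u y] is [u x] plus the difference quotient times [y - x], and this product tends to
    0. *)
Lemma C1_on_within_continuous : {within [set` I], continuous u}.
Proof.
apply/subspace_continuousP => x xI; have [/(_ x xI) cq _] := hC1.
have cu : u @ within [set` I] x^' --> u x.
  have ctr : (fun y => y - x) @ within [set` I] x^' --> (0 : R).
    apply: cvg_trans (_ : (fun y => y - x) @ nbhs x --> (0 : R)).
      apply: cvg_app => A [e /= e0 eA]; exists e => // z ez _ _; exact: eA.
    rewrite -[X in _ --> X](subrr x).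
    by apply: cvgB; [exact: cvg_id|exact: cvg_cst].
  have H : (fun y => u x + diff_quotient u x y * (y - x)) @
      within [set` I] x^' --> u x.
    rewrite -[X in _ --> X]addr0 -[X in _ + X](mulr0 (derive_in I u x)).
    by apply: cvgD; [exact: cvg_cst|exact: cvgM].
  apply: cvg_trans H; apply: near_eq_cvg.
  exists 1 => //= z _ zx zI /=.
  by rewrite /diff_quotient /= divfK ?subr_eq0// [LHS]addrC subrK.
move=> P nP; have /= := cu P nP.
rewrite /fmap/= /within/= => -[e /= e0 eP]; exists e => //= z ez zI.
have [->|zx] := eqVneq z x; first exact: nbhs_singleton.
exact: eP.
Qed.

(** Difference quotients of an increasing function are nonnegative, hence so is their limit; the
    second point [y] makes the filter proper. *)
Lemma derive_in_gt0 (x y : R) : x \in I -> y \in I -> x != y ->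
  derive_in I u x != 0 -> 0 < derive_in I u x.
Proof.
move=> xI yI xy d0; rewrite lt_neqAle eq_sym d0 /=.
have [/(_ x xI) cq _] := hC1.
have := within_dnbhs_itv_proper xI yI xy => PF.
apply: limr_ge => //; exists 1 => //= z _ zx zI.
rewrite /diff_quotient; have [xz|xz|xz] := ltgtP x z.
- by rewrite divr_ge0// ?subr_ge0 ltW// hincr.
- by rewrite -mulrNN -invrN !opprB divr_ge0// ?subr_ge0 ltW// hincr.
- by move: zx; rewrite xz eqxx.
Qed.

(** Between two points of [I], small increments of either sign stay in [I], so the limit inside [I]
    is the ordinary derivative. *)
Lemma interior_is_derive (c d x : R) : c \in I -> d \in I -> c < x -> x < d ->
  derivable u x 1 /\ derive1 u x = derive_in I u x.
Proof.
move=> cI dI cx xd.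
have xI : x \in I by apply: itv_convex cI dI (ltW cx) (ltW xd).
have [/(_ x xI) cq _] := hC1.
have xc : (fun h : R => h^-1 *: (u (h *: 1 + x) - u x)) @ 0^' -->
    derive_in I u x.
  apply: cvg_trans cq => P /=; rewrite /fmap/= /within/= => -[e /= e0 eP].
  exists (Num.min e (Num.min (x - c) (d - x))).
    by rewrite /= !lt_min e0 !subr_gt0 cx xd.
  move=> h /=; rewrite sub0r normrN !lt_min !ltr_norml.
  move=> /andP[/andP[he1 he2] /andP[/andP[h1 h2] /andP[h3 h4]]] h0.
  have := eP (h + x); rewrite /diff_quotient addrK.
  rewrite /GRing.scale/= mulr1 mulrC; apply.
  - by rewrite /= opprD addrC addrNK normrN ltr_norml he1.
  - by rewrite -subr_eq0 addrK.
  - by apply: itv_convex cI dI _ _; lra.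
have dx : derivable u x 1 by apply/cvg_ex; exists (derive_in I u x).
by split => //; rewrite derive1E; exact: (cvg_lim _ xc).
Qed.

(** The fundamental theorem asks for the ordinary derivative only on ]c, d[ and for one-sided
    continuity at [c] and [d], which may therefore be end points of [I]. *)
Lemma integral_derive_in_itv (c d : R) : c \in I -> d \in I -> c <= d ->
  (\int[@lebesgue_measure R]_(x in `[c, d]) (derive_in I u x)%:E =
   (u d - u c)%:E)%E.
Proof.
move=> cI dI; rewrite le_eqVlt => /predU1P[<-|cd].
  by rewrite set_itv1 integral_set1 subrr.
have sub : `[c, d] `<=` [set` I].
  by move=> z /=; rewrite in_itv/= => /andP[? ?]; exact: itv_convex cI dI _ _.
have [_ cd'] := hC1; rewrite EFinB; apply: continuous_FTC2 => //.
- exact: continuous_subspaceW cd'.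
- have cu := continuous_subspaceW sub C1_on_within_continuous.
  have [_ l r] := (continuous_within_itvP _ cd).1 cu.
  split => // x; rewrite in_itv/= => /andP[cx xd].
  by have [] := interior_is_derive cI dI cx xd.
- move=> x; rewrite in_itv/= => /andP[cx xd].
  by have [] := interior_is_derive cI dI cx xd.
Qed.

End derivative_on_interval.

(** * The fractional part *)

Lemma fracpartE (R : realType) (x : R) (k : int) :
  k%:~R <= x -> x < k%:~R + 1 -> fracpart x = x - k%:~R.
Proof.
by move=> kx xk; rewrite /fracpart (@floor_def _ _ k)// kx intrD.
Qed.

Lemma fracpart_ge0 (R : realType) (x : R) : 0 <= fracpart x.
Proof. by rewrite /fracpart subr_ge0 floor_le. Qed.

Lemma fracpart_lt1 (R : realType) (x : R) : fracpart x < 1.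
Proof. by rewrite /fracpart ltrBlDl -intrD1 floorD1_gt. Qed.

Lemma measurable_fracpart (R : realType) :
  measurable_fun [set: R] (@fracpart R).
Proof.
apply: measurable_funB => //; apply: nondecreasing_measurable => //.
by move=> x y xy; rewrite ler_int; exact: le_floor.
Qed.

(** * Sequences exhausting a set of reals, and superlevel sets *)

(** If [S] has a maximum, a constant sequence serves. Otherwise choose for each rational [q] a point
    of [S] above [q], if any, and take running maxima: some rational lies between a given point of
    [S] and a larger one. *)
Lemma cofinal_nondecreasing_seq (R : realType) (S : set R) : S !=set0 ->
  exists d : R ^nat, [/\ nondecreasing_seq d, forall n, S (d n) &
    forall x, S x -> exists n, x <= d n].
Proof.
move=> [s0 Ss0].
have [[M [SM Mmax]]|nomax] := pselect (exists M, S M /\ ubound S M).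
  by exists (fun=> M); split => // x Sx; exists 0%N; exact: Mmax.
(* [unpickle] enumerates the rationals; [s0] is the default for codes of no rational and for [q]
   exceeding all of [S]. *)
pose e n := if unpickle n is Some q
  then xget s0 [set y | S y /\ ratr (q : rat) <= y] else s0.
have Se n : S (e n).
  rewrite /e; case: unpickle => // q.
  by case: xgetP => [y _ []|].
exists (fun n => \big[Num.max/s0]_(i < n) e i); split.
- by move=> m n mn; exact: (le_bigmax_ord xpredT).
- move=> n; elim/big_ind: _ => // x y Sx Sy.
  by case: (leP x y).
- move=> x Sx.
  have [y Sy xy] : exists2 y, S y & x < y.
    apply: contrapT => /forall2NP H; apply: nomax; exists x; split => // y Sy.
    by have [//|/negP] := H y; rewrite -leNgt.
  have [q] := rat_in_itvoo xy; rewrite in_itv/= => /andP[xq qy].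
  exists (pickle q).+1; apply: (bigmax_sup ord_max) => //=.
  rewrite /e pickleK; case: xgetP => [z _ [_ qz]|/(_ y) []].
    by rewrite (le_trans (ltW xq)).
  by split => //; exact: ltW.
Qed.

Lemma coinitial_nonincreasing_seq (R : realType) (S : set R) : S !=set0 ->
  exists c : R ^nat, [/\ nonincreasing_seq c, forall n, S (c n) &
    forall x, S x -> exists n, c n <= x].
Proof.
move=> [s0 Ss0].
have [|d [nd Sd dS]] := @cofinal_nondecreasing_seq R [set - x | x in S].
  by exists (- s0), s0.
exists (fun n => - d n); split.
- by move=> m n mn; rewrite lerN2 nd.
- by move=> n; have [y Sy <-] := Sd n; rewrite opprK.
- move=> x Sx; have [|n xn] := dS (- x); first by exists x.
  by exists n; rewrite lerNl.
Qed.

(* The value at 0 of a function satisfying [unimodal_with_max] is only bounded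
   above, hence its superlevel sets are intervals only up to the point 0. *)
Lemma unimodal_superlevel (R : realType) (I : interval R) (g : R -> R)
    (m t : R) : unimodal_with_max I g m ->
  exists S : set R, [/\ is_interval S, S `<=` [set` I],
    ([set` I] `&` [set x | t < g x]) `\ 0 `<=` S &
    S `\ 0 `<=` [set` I] `&` [set x | t < g x]].
Proof.
move=> [a [[a0 aI] _ pos neg dec]].
pose L := ([set` I] `&` [set x | t < g x]) `\ 0.
(* The order-convex hull of [L] is taken as the interval. *)
exists [set x | exists y z, [/\ L y, L z, y <= x & x <= z]]; split.
- move=> x z [y [_ [Ly _ yx _]]] [_ [y' [_ Ly' _ zy']]] w /andP[xw wz].
  by exists y, y'; split => //; [exact: le_trans xw|exact: le_trans wz _].
- by move=> x [y [z [[[yI _] _] [[zI _] _] yx xz]]]; exact: itv_convex yI zI _ _.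
- by move=> x Lx; exists x, x.
- move=> x [[y [z [[[yI ty] y0] [[zI tz] z0] yx xz]]] x0].
  have xI : x \in I by exact: itv_convex yI zI _ _.
  (* Right of [a], compare with the right witness [z]. Left of [a], compare with the left witness
     [y]: it is nonzero, so the clause for its sign applies, and the clause for negative points
     reaches across 0. *)
  split => //=; have [xa|ax] := leP x a; last first.
    by apply: lt_le_trans tz _; apply: dec => //; exact: ltW.
  apply: lt_le_trans ty _; have [y_lt0|y_gt0|y_eq0] := ltgtP y 0.
  - exact: neg.
  - exact: pos.
  - by case: y0.
Qed.

(** * The measure with density u' on sets of prescribed fractional part *)

Section integral_of_derivative.
Context (R : realType) (I : interval R) (u : R -> R).
Hypotheses (hC1 : C1_on I u) (hincr : {in I &, {homo u : x y / x < y}}).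
Hypothesis hpos : {in I, forall x, 0 < derive_in I u x}.

Local Notation nu A :=
  (\int[@lebesgue_measure R]_(x in A) (derive_in I u x)%:E)%E.
Local Notation cell a b := [set x | a <= fracpart (u x) < b].

Lemma measurable_derive_in (A : set R) : measurable A -> A `<=` [set` I] ->
  measurable_fun A (fun x => (derive_in I u x)%:E).
Proof.
move=> mA AI; apply/measurable_EFinP.
apply: (@measurable_funS _ _ _ _ [set` I]) => //; have [_ c] := hC1.
exact: subspace_continuous_measurable_fun.
Qed.

Lemma measurable_setI_cell (A : set R) (a b : R) : measurable A ->
  A `<=` [set` I] -> measurable (A `&` cell a b).
Proof.
move=> mA AI.
have mu : measurable_fun A u.
  apply: (@measurable_funS _ _ _ _ [set` I]) => //.
  apply: subspace_continuous_measurable_fun => //.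
  exact: C1_on_within_continuous.
have := measurableT_comp (@measurable_fracpart R) mu.
move=> /(_ mA `[a, b[%classic); rewrite /preimage/=; apply.
exact: measurable_itv.
Qed.

Lemma derive_in_ge0 (A : set R) : A `<=` [set` I] ->
  forall x, A x -> (0 <= (derive_in I u x)%:E)%E.
Proof. by move=> AI x /AI xI; rewrite lee_fin ltW// hpos. Qed.

Lemma le_nu (A B : set R) : measurable A -> measurable B -> A `<=` B ->
  B `<=` [set` I] -> (nu A <= nu B)%E.
Proof.
move=> mA mB AB BI; apply: ge0_subset_integral => //.
- exact: measurable_derive_in.
- exact: derive_in_ge0.
Qed.

Let u_mono : {in I &, {mono u : x y / x <= y}}.
Proof. exact: le_mono_in. Qed.

Let u_ivt (c d r : R) : c \in I -> d \in I -> u c <= r -> r <= u d ->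
  exists x, [/\ x \in I, c <= x, x <= d & u x = r].
Proof.
move=> cI dI cr rd; have cd : c <= d by rewrite -u_mono// (le_trans cr).
have sub : `[c, d] `<=` [set` I].
  by move=> z /=; rewrite in_itv/= => /andP[? ?]; exact: itv_convex cI dI _ _.
have cu := continuous_subspaceW sub (C1_on_within_continuous hC1).
have [|x xcd ux] := IVT (v := r) cd cu.
  by rewrite ge_min cr le_max rd orbT.
exists x; split => //; first exact: sub.
- by move: xcd; rewrite in_itv/= => /andP[].
- by move: xcd; rewrite in_itv/= => /andP[].
Qed.

(** Induction on [N]: each unit of growth of [u] contributes the preimage of some [j + a, j + b[
    with [j] an integer, whose [nu]-mass is [b - a]. *)
Lemma nu_cell_int (a b c d : R) (k : int) (N : nat) :
  0 <= a -> a <= b -> b <= 1 -> c \in I -> d \in I ->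
  u c = k%:~R -> u d = k%:~R + N%:R ->
  ((N%:R * (b - a))%:E <= nu (`[c, d[ `&` cell a b))%E.
Proof.
move=> a0 ab b1 cI + ck.
have sub x y : x \in I -> y \in I -> `[x, y[ `<=` [set` I].
  move=> xI yI z /=; rewrite in_itv/= => /andP[? ?].
  by apply: itv_convex xI yI _ _ => //; exact: ltW.
elim: N d => [d dI ud|N ih d dI ud].
  rewrite mul0r; apply: integral_ge0 => x [xcd _].
  by apply: (derive_in_ge0 (sub _ _ cI dI)).
(* [e] splits off the last unit, in which [u] maps [p, q[ onto [k + N + a, k + N + b[. *)
have [||e [eI ce ed ue]] := u_ivt (r := k%:~R + N%:R) cI dI.
- by rewrite ck lerDl ler0n.
- by rewrite ud -natr1; lra.
have [||p [pI ep pd up]] := u_ivt (r := k%:~R + N%:R + a) eI dI.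
- by rewrite ue; lra.
- by rewrite ud -natr1; lra.
have [||q [qI pq qd uq]] := u_ivt (r := k%:~R + N%:R + b) pI dI.
- by rewrite up; lra.
- by rewrite ud -natr1; lra.
have kN : k%:~R + N%:R = (k + N%:Z)%:~R :> R by rewrite intrD.
have mC : measurable (`[c, e[ `&` cell a b).
  by apply: measurable_setI_cell => //; exact: sub.
have UI : (`[c, e[ `&` cell a b) `|` `[p, q[ `<=` `[c, d[ `&` cell a b.
  move=> x [[]|] /=; rewrite !in_itv/=.
    by move=> /andP[cx xe] ?; rewrite cx (lt_le_trans xe).
  move=> /andP[px xq].
  rewrite (le_trans ce (le_trans ep px)) (lt_le_trans xq qd); split => //.
  have xI : x \in I by apply: itv_convex pI qI px (ltW xq).
  have upx : u p <= u x by rewrite u_mono.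
  have uxq : u x < u q by rewrite hincr.
  (* Since 0 <= a and b <= 1, the floor of [u] on [p, q[ is [k + N]. *)
  rewrite (@fracpartE _ _ (k + N%:Z)) -?kN; lra.
apply: le_trans (le_nu _ _ UI _); last first.
- by move=> x [/(sub _ _ cI dI)].
- by apply: measurable_setI_cell => //; exact: sub.
- exact: measurableU.
rewrite ge0_integral_setU//=; last 3 first.
- apply: measurable_derive_in; first exact: measurableU.
  by move=> x /UI[/(sub _ _ cI dI)].
- apply: derive_in_ge0.
  by move=> x /UI[/(sub _ _ cI dI)].
- apply/disj_setPLR => x /= [] ; rewrite !in_itv/= => /andP[cx xe] _ /andP[px _].
  by have := lt_le_trans xe (le_trans ep px); rewrite ltxx.
rewrite integral_itv_bndo_bndc; last first.
  by apply: measurable_derive_in => //; exact: sub.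
rewrite (integral_derive_in_itv hC1)// uq up -natr1 mulrDl mul1r EFinD.
apply: leeD; first exact: ih.
by rewrite lee_fin; lra.
Qed.

(** Between the first and the last integer level of [u] on [c, d] the count of full cells applies;
    at most one unit is lost at each end, hence the 2. *)
Lemma nu_cell_segment (a b c d : R) : 0 <= a -> a <= b -> b <= 1 ->
  c \in I -> d \in I ->
  (((b - a) * (u d - u c - 2))%:E <= nu (`[c, d] `&` cell a b))%E.
Proof.
move=> a0 ab b1 cI dI.
have sub x y : x \in I -> y \in I -> `[x, y] `<=` [set` I].
  by move=> xI yI z /=; rewrite in_itv/= => /andP[? ?]; exact: itv_convex xI yI _ _.
have [small|big] := leP (u d - u c) 2.
  apply: (@le_trans _ _ 0%E).
    by rewrite lee_fin mulr_ge0_le0//; lra.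
  by apply: integral_ge0 => x [xcd _]; apply: (derive_in_ge0 (sub _ _ cI dI)).
(* [k] is the least integer strictly above [u c] and [l] the greatest one not above [u d], so l - k
   > u d - u c - 2, which is positive here. *)
set k := (Num.floor (u c) + 1)%R; set l := Num.floor (u d).
have k1 : u c < k%:~R by exact: floorD1_gt.
have k2 : k%:~R <= u c + 1 by rewrite intrD lerD2r floor_le.
have l1 : l%:~R <= u d by exact: floor_le.
have l2 : u d < l%:~R + 1 by rewrite -intrD1 floorD1_gt.
have kl : k <= l by rewrite -(ler_int R); lra.
pose N := `|l - k|%N.
have NE : N%:R = l%:~R - k%:~R :> R.
  by rewrite -intrB pmulrn /N gez0_abs// subr_ge0.
have [||c' [c'I cc' c'd uc']] := u_ivt (r := k%:~R) cI dI; [lra|lra|].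
have [||d' [d'I c'd' d'd ud']] := u_ivt (r := l%:~R) c'I dI; [lra|lra|].
have sub' : `[c', d'[ `<=` `[c, d].
  move=> x /=; rewrite !in_itv/= => /andP[? xd'].
  by rewrite (le_trans cc')//= (le_trans (ltW xd')).
apply: le_trans (le_nu _ _ (@setSI _ (cell a b) _ _ sub') _); last first.
- by move=> x [/(sub _ _ cI dI)].
- by apply: measurable_setI_cell => //; exact: sub.
- by apply: measurable_setI_cell => //; apply: subset_trans sub' _; exact: sub.
apply: le_trans (nu_cell_int (k := k) (N := N) a0 ab b1 c'I d'I uc' _); last first.
  by rewrite NE ud' addrC subrK.
by rewrite lee_fin NE mulrC ler_wpM2r; lra.
Qed.

(** Exhaust [S] by segments with end points in [S] and pass to the limit. The loss stands on the
    right, so that nothing is subtracted when [nu S] is infinite. *)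
Lemma nu_cell_is_interval (a b : R) (S : set R) : 0 <= a -> a <= b -> b <= 1 ->
  is_interval S -> S `<=` [set` I] ->
  ((b - a)%:E * nu S <= nu (S `&` cell a b) + (2 * (b - a))%:E)%E.
Proof.
move=> a0 ab b1 iS SI.
have ba0 : 0 <= b - a by lra.
have [->|S0] := eqVneq S set0.
  by rewrite set0I integral_set0 mule0 add0e lee_fin mulr_ge0.
have {}S0 : S !=set0 by exact/set0P.
have [c [nc Sc cS]] := coinitial_nonincreasing_seq S0.
have [d [nd Sd dS]] := cofinal_nondecreasing_seq S0.
have mS : measurable S by exact: is_interval_measurable.
have sub n : `[c n, d n] `<=` S.
  by move=> x /=; rewrite in_itv/=; exact: iS.
have SE : S = \bigcup_n `[c n, d n]%classic.
  apply/seteqP; split; last by move=> x [n _] /sub.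
  move=> x Sx; have [p cx] := cS x Sx; have [q xd] := dS x Sx.
  exists (maxn p q) => //=; rewrite in_itv/=.
  rewrite (le_trans (nc _ _ (leq_maxl p q)) cx)/=.
  exact: le_trans xd (nd _ _ (leq_maxr p q)).
have lim : nu `[c n, d n] @[n --> \oo] --> nu S.
  rewrite [in X in _ --> X]SE; apply: ge0_nondecreasing_set_cvg_integral => //.
  - move=> m n mn; rewrite subsetEset => x /=; rewrite !in_itv/= => /andP[cx xd].
    by rewrite (le_trans (nc _ _ mn) cx) (le_trans xd (nd _ _ mn)).
  - by move=> n; apply: measurable_derive_in => //; exact: subset_trans (sub n) _.
  - by move=> n; apply: derive_in_ge0; exact: subset_trans (sub n) _.
have ba_fin : (b - a)%:E \is a fin_num by [].
have {}lim := cvgeZl ba_fin lim.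
apply: cvge_le lim; apply: nearW => n.
(* [c] and [d] are chosen independently, so a segment may be empty. *)
have [cd|dc] := leP (c n) (d n); last first.
  rewrite set_itv_ge ?bnd_simp -?ltNge// integral_set0 mule0.
  rewrite adde_ge0//; last by rewrite lee_fin mulr_ge0.
  by apply: integral_ge0 => x [/SI xI _]; rewrite lee_fin ltW// hpos.
rewrite (integral_derive_in_itv hC1)//; [|exact: SI|exact: SI].
apply: (@le_trans _ _ (((b - a) * (u (d n) - u (c n) - 2))%:E + (2 * (b - a))%:E)%E).
  by rewrite -EFinM -EFinD lee_fin; lra.
rewrite leeD2r//; apply: le_trans (nu_cell_segment a0 ab b1 _ _) _.
- exact: SI.
- exact: SI.
- apply: le_nu; [| |exact: setSI|by move=> x [/SI]].
  + by apply: measurable_setI_cell => //; exact: subset_trans (sub n) _.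
  + exact: measurable_setI_cell.
Qed.

(** The superlevel set and the interval from [unimodal_superlevel] differ at most at 0, a null set,
    so the bound carries over. *)
Lemma nu_cell_superlevel (g : R -> R) (m t a b : R) :
  0 <= a -> a <= b -> b <= 1 ->
  measurable_fun [set` I] g -> unimodal_with_max I g m ->
  ((b - a)%:E * nu ([set` I] `&` [set x | (t < g x)%R]) <=
   nu ([set` I] `&` [set x | (t < g x)%R] `&` cell a b) + (2 * (b - a))%:E)%E.
Proof.
move=> a0 ab b1 mg ug.
have [S [iS SI]] := unimodal_superlevel t ug.
set L := [set` I] `&` _ => LS SL.
have mL : measurable L by rewrite /L -preimage_itvoy; exact: mg.
have mS : measurable S by exact: is_interval_measurable.
have LI : L `<=` [set` I] by exact: subIsetl.
have nuD0 A : measurable A -> A `<=` [set` I] -> nu (A `\ 0%R) = nu A.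
  move=> mA AI; have mA0 : measurable (A `\ 0) by exact: measurableD.
  by apply: integral_setD1 => //; apply: measurable_derive_in => // x [/AI].
have CI A : A `<=` [set` I] -> A `&` cell a b `<=` [set` I].
  by move=> AI x [/AI].
apply: (@le_trans _ _ ((b - a)%:E * nu S)%E).
  rewrite lee_wpmul2l ?lee_fin ?subr_ge0// -nuD0//.
  by apply: le_nu => //; exact: measurableD.
apply: le_trans (nu_cell_is_interval a0 ab b1 iS SI) _.
rewrite leeD2r// -nuD0; [|exact: measurable_setI_cell|exact: CI].
apply: le_nu => //.
- by apply: measurableD => //; exact: measurable_setI_cell.
- exact: measurable_setI_cell.
- by move=> x [[Sx cx] x0]; split => //; exact: SL.
- exact: CI.
Qed.

End integral_of_derivative.

(** * The layer cake formula *)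

(** Tonelli for the function equal to v(x) where 0 <= t < g(x) and to 0 elsewhere: integrating in t
    gives g(x) v(x), integrating in x gives [level t] on [0, m] and 0 outside. Tonelli also yields
    the measurability of [level], used to integrate inequalities in t. *)
Lemma layer_cake (R : realType) (A : set R) (g v : R -> R) (m : R) :
  measurable A -> measurable_fun A g -> measurable_fun A v ->
  (forall x, A x -> 0 <= v x) -> (forall x, A x -> 0 <= g x <= m) ->
  let level t :=
    (\int[@lebesgue_measure R]_(x in A `&` [set x | (t < g x)%R]) (v x)%:E)%E in
  measurable_fun `[0, m] level /\
  (\int[@lebesgue_measure R]_(x in A) (g x * v x)%:E =
   \int[@lebesgue_measure R]_(t in `[0%R, m]) level t)%E.
Proof.
move=> mA mg mv v0 gm level.
pose h (z : R * R) : \bar R :=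
  (if (0 <= z.2) && (z.2 < (g \_ A) z.1) then (v \_ A) z.1 else 0)%:E.
have mgA : measurable_fun [set: R] (g \_ A) by exact/(measurable_restrictT g).
have mvA : measurable_fun [set: R] (v \_ A) by exact/(measurable_restrictT v).
have mh : measurable_fun [set: R * R] h.
  apply/measurable_EFinP; apply: measurable_fun_if => //=.
  - apply: measurable_and => //=; first exact: measurable_fun_ler.
    by apply: measurable_fun_ltr => //; exact: measurableT_comp.
  - by apply: measurable_funTS; exact: measurableT_comp.
have h0 z : (0 <= h z)%E.
  rewrite lee_fin /h; case: ifPn => // _; rewrite patchE.
  by case: ifPn => // /set_mem; exact: v0.
have hx x : (\int[@lebesgue_measure R]_t h (x, t) =
    ((fun x => (g x * v x)%:E) \_ A) x)%E.
  rewrite patchE; case: ifPn => xA; last first.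
    rewrite integral0_eq// => t _; rewrite /h/= !patchE (negbTE xA).
    by case: ifP.
  have := gm x (set_mem xA) => /andP[gx0 gxm].
  rewrite (_ : (fun t => h (x, t)) = ((fun=> (v x)%:E) \_ `[0, g x[)); last first.
    by apply/funext => t; rewrite /h/= !patchE xA mem_setE in_itv/=; case: ifP.
  rewrite -integral_mkcond integral_cst//= lebesgue_measure_itv/= lte_fin.
  rewrite muleC EFinM; case: ltgtP gx0 => // [_ _|<-].
    by rewrite oppr0 adde0.
  by rewrite mul0e.
have ht t : (\int[@lebesgue_measure R]_x h (x, t) = (level \_ `[0%R, m]) t)%E.
  rewrite patchE mem_setE in_itv/=; case: ifPn => tm; last first.
    rewrite integral0_eq// => x _; rewrite /h/= !patchE.
    case: (boolP (x \in A)) => xA; last by case: ifP.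
    rewrite ifF//; apply: contraNF tm => /andP[-> tg] /=.
    by have /andP[_] := gm x (set_mem xA); apply: le_trans; exact: ltW.
  rewrite /level [RHS]integral_mkcond; apply: eq_integral => x _.
  have /andP[t0 _] := tm; rewrite /h/= !patchE t0 /=.
  case: (boolP (x \in A)) => xA.
    have -> : (x \in A `&` [set x | t < g x]) = (t < g x).
      by rewrite in_setI xA; apply/idP/idP; rewrite inE.
    by case: ifP.
  by rewrite in_setI (negbTE xA) /=; case: ifP.
split.
  apply/(measurable_restrictT level) => //.
  have <- : (fun t => \int[@lebesgue_measure R]_x h (x, t))%E =
      level \_ `[0, m] by apply/funext => t; exact: ht.
  exact: measurable_fun_fubini_tonelli_G.
rewrite integral_mkcond [RHS]integral_mkcond.
transitivity (\int[@lebesgue_measure R]_x \int[@lebesgue_measure R]_t h (x, t))%E.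
  by apply: eq_integral => x _; rewrite hx.
rewrite fubini_tonelli//.
by apply: eq_integral => t _; rewrite ht.
Qed.

(** * The law of the fractional part of u(X) *)

Section random_variable_with_density.
Context (R : realType) (I : interval R) (u : R -> R).
Hypotheses (hC1 : C1_on I u) (hincr : {in I &, {homo u : x y / x < y}}).
Hypothesis hu' : {in I, forall x, derive_in I u x != 0}.
Context d (T : measurableType d) (P : probability T R) (X : {RV P >-> R}).
Variables (f : R -> R) (m : R).
Hypotheses (XI : forall t, X t \in I) (hf : has_density_on X I f).
Hypothesis hg : unimodal_with_max I (fun x => f x / derive_in I u x) m.

Local Notation v := (derive_in I u).
Local Notation g := (fun x => f x / derive_in I u x).

Lemma integral_density :
  (\int[@lebesgue_measure R]_(x in [set` I]) (f x)%:E = 1)%E.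
Proof.
have [_ _ /(_ setT measurableT)] := hf; rewrite setTI => <-.
exact: probability_setT.
Qed.

(** By [derive_in_gt0], a point where [v] is not positive would be the only point of [I]; then [I]
    is null and [f] cannot have integral 1. *)
Lemma derive_in_gt0_on : {in I, forall x, 0 < v x}.
Proof.
move=> x xI; apply: contrapT => nv.
have sub1 : [set` I] `<=` [set x].
  move=> y yI; apply: contrapT => /eqP yx; apply: nv.
  by apply: (derive_in_gt0 hC1 hincr xI yI); [rewrite eq_sym|exact: hu'].
have /eqP := integral_density.
by rewrite (integral_Sset1 x)// lt_eqF// lte_fin ltr01.
Qed.

Let mv : measurable_fun [set` I] v.
Proof. by apply/measurable_EFinP; exact: measurable_derive_in. Qed.

Let mg : measurable_fun [set` I] g.
Proof.
have [mf _ _] := hf; apply: measurable_funM => //.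
apply: subspace_continuous_measurable_fun => //.
have [_ /subspace_continuousP cv] := hC1; apply/subspace_continuousP => x xI.
by apply: cvgV; [exact: hu'|exact: cv].
Qed.

Let gm : {in I, forall x, 0 <= g x <= m}.
Proof.
have [_ f0 _] := hf; have [a [_ [_ gm] _ _ _]] := hg.
by move=> x xI; rewrite gm// divr_ge0 ?f0// ltW// derive_in_gt0_on.
Qed.

Let f_gv : {in I, forall x, f x = g x * v x}.
Proof. by move=> x xI; rewrite divfK ?hu'. Qed.

(** As 0 <= g <= m, a nonpositive [m] would force f = g v = 0 on [I], against total mass 1. *)
Lemma max_density_quotient_gt0 : 0 < m.
Proof.
rewrite ltNge; apply/negP => m0.
have /eqP := integral_density; rewrite integral0_eq ?lt_eqF ?lte_fin//.
move=> x xI; rewrite f_gv//; have /andP[g0 gm'] := gm xI.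
by rewrite (_ : g x = 0) ?mul0r//; apply/eqP; rewrite eq_le g0 (le_trans gm').
Qed.

(** The layer cake formula turns the total mass and the probability of the cell into integrals over
    t in [0, m]. [nu_cell_superlevel] compares the integrands, and its error 2 (b - a) integrates to
    2 (b - a) m. *)
Lemma prob_cell_ge (a b : R) : 0 <= a -> a <= b -> b <= 1 ->
  ((b - a)%:E <= P [set t | (a <= fracpart (u (X t)) < b)%R] +
                 (2 * (b - a) * m)%:E)%E.
Proof.
move=> a0 ab b1; have m0 := max_density_quotient_gt0.
pose C := [set x | a <= fracpart (u x) < b].
have [mf f0 distE] := hf.
have mC : measurable ([set` I] `&` C).
  by apply: (measurable_setI_cell hC1).
have -> : [set t | a <= fracpart (u (X t)) < b] = X @^-1` ([set` I] `&` C).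
  by apply/seteqP; split => t; [move=> tC; split; [exact: XI|]|case].
have -> : P (X @^-1` ([set` I] `&` C)) =
    (\int[@lebesgue_measure R]_(x in [set` I] `&` C) (g x * v x)%:E)%E.
  rewrite -[LHS]/(distribution P X _) distE// setIAC setIid.
  by apply: eq_integral => x /set_mem[xI _]; rewrite -f_gv.
have v0 x : [set` I] x -> 0 <= v x by move=> xI; rewrite ltW// derive_in_gt0_on.
have [mL LE] := layer_cake (measurable_itv I) mg mv v0 gm.
have [mLC LCE] : _ /\ _ := layer_cake mC (measurable_funS (measurable_itv I)
  (@subIsetl _ _ _) mg) (measurable_funS (measurable_itv I)
  (@subIsetl _ _ _) mv) (fun x xC => v0 x xC.1) (fun x xC => gm xC.1).
have LC t : [set` I] `&` C `&` [set x | t < g x] =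
    [set` I] `&` [set x | t < g x] `&` C by rewrite setIAC.
rewrite LCE -[leLHS]mule1 -integral_density.
have -> : (\int[@lebesgue_measure R]_(x in [set` I]) (f x)%:E =
    \int[@lebesgue_measure R]_(x in [set` I]) (g x * v x)%:E)%E.
  by apply: eq_integral => x /set_mem xI; rewrite -f_gv.
have nu0 A : A `<=` [set` I] ->
    (0 <= \int[@lebesgue_measure R]_(x in A) (v x)%:E)%E.
  by move=> AI; apply: integral_ge0 => x /AI xI; rewrite lee_fin v0.
have ba0 : 0 <= b - a by lra.
rewrite LE -ge0_integralZl//; last first.
  by move=> t _; apply: nu0; exact: subIsetl.
have -> : ((2 * (b - a) * m)%:E =
    \int[@lebesgue_measure R]_(t in `[0%R, m]) (2 * (b - a))%:E)%E.
  by rewrite integral_cst//= lebesgue_measure_itv/= lte_fin m0 oppr0 adde0.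
rewrite -ge0_integralD//; last 2 first.
- by move=> t _; apply: nu0 => x [[]].
- by move=> t _; rewrite lee_fin mulr_ge0.
apply: ge0_le_integral => //.
- move=> t _; apply: mule_ge0; first by rewrite lee_fin.
  by apply: nu0; exact: subIsetl.
- exact: measurable_funeM.
- exact: emeasurable_funD.
- move=> t _; rewrite LC.
  exact: (nu_cell_superlevel hC1 hincr derive_in_gt0_on t a0 ab b1 mg hg).
Qed.

(** [u] is arbitrary outside [I], so it is replaced there by 0; the composite with [X] is
    unchanged. *)
Lemma measurable_fracpart_comp :
  measurable_fun [set: T] (fun t => fracpart (u (X t))).
Proof.
have mu : measurable_fun [set: R] (u \_ [set` I]).
  apply/(measurable_restrictT u) => //.
  apply: subspace_continuous_measurable_fun => //.
  exact: C1_on_within_continuous.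
have -> : (fun t => fracpart (u (X t))) =
    @fracpart R \o ((u \_ [set` I]) \o X).
  by apply/funext => t /=; rewrite patchE mem_setE XI.
apply: measurableT_comp; first exact: measurable_fracpart.
exact: measurableT_comp.
Qed.

Lemma prob_fracpart_lt (z : R) : 0 <= z -> z < 1 ->
  (`|P [set t | (fracpart (u (X t)) < z)%R] - z%:E| < (2 * m)%:E)%E.
Proof.
move=> z0 z1; have m0 := max_density_quotient_gt0.
set A := [set t | (fracpart (u (X t)) < z)%R].
have mA : measurable A.
  rewrite -[A]setTI /A -preimage_itvNyo.
  exact: measurable_fracpart_comp.
(* With p the probability of [A], these give z - p <= 2 z m and p - z <= 2 (1 - z) m. *)
have lo := prob_cell_ge (lexx 0) z0 (ltW z1).
have hi := prob_cell_ge z0 (ltW z1) (lexx 1).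
have EA : [set t | 0 <= fracpart (u (X t)) < z] = A.
  by apply/seteqP; split => t /=; rewrite fracpart_ge0.
have EAC : [set t | z <= fracpart (u (X t)) < 1] = ~` A.
  by apply/seteqP; split => t /=; rewrite fracpart_lt1 andbT leNgt => /negP.
move: lo hi; rewrite EA EAC probability_setC// subr0.
have PA : P A \is a fin_num by exact: fin_num_measure.
rewrite -(fineK PA) -EFinB -!EFinD !lee_fin abse_EFin lte_fin ltr_norml.
set p := fine _ => lo hi.
(* At z = 0 the upper bound is only p <= 2 m, and strictness comes from [A] being empty. Otherwise z
   and 1 - z are both below 1, and m > 0. *)
have [z_eq0|z_neq0] := eqVneq z 0.
  have A0 : A = set0.
    by apply/seteqP; split => t //=; rewrite /A/= z_eq0 ltNge fracpart_ge0.
  have -> : p = 0 by rewrite /p A0 measure0.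
  by rewrite z_eq0; lra.
have zgt0 : 0 < z by rewrite lt_neqAle eq_sym z_neq0.
by apply/andP; split; nra.
Qed.

End random_variable_with_density.

(** * The uniform distribution function and convergence in law *)

Lemma uniform01_ge1 (R : realType) (x : R) : 1 <= x ->
  @uniform01 R `]-oo, x]%classic = 1%E.
Proof.
move=> x1; apply: (integral_uniform_pdf1 ltr01) => y /=.
by rewrite !in_itv/= => /andP[_ y1]; exact: le_trans x1.
Qed.

Lemma uniform01_lt0 (R : realType) (x : R) : x < 0 ->
  @uniform01 R `]-oo, x]%classic = 0%E.
Proof.
move=> x0; rewrite /uniform01 /uniform_prob integral_uniform_pdf.
rewrite (_ : _ `&` _ = set0) ?integral_set0//.
apply/seteqP; split => // y [] /=; rewrite !in_itv/= => yx /andP[y0 _].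
by move: x0; rewrite ltNge (le_trans y0 yx).
Qed.

Lemma uniform01_itv01 (R : realType) (x : R) : 0 <= x -> x <= 1 ->
  @uniform01 R `]-oo, x]%classic = x%:E.
Proof.
move=> x0 x1; rewrite /uniform01 /uniform_prob integral_uniform_pdf.
have -> : `]-oo, x] `&` `[0, 1] = `[0, x]%classic :> set R.
  apply/seteqP; split => y /=; rewrite !in_itv/=; first by move=> [-> /andP[->]].
  by move=> /andP[-> yx]; rewrite yx (le_trans yx x1).
rewrite (eq_integral (cst 1%E)) ?integral_cst//=.
  rewrite lebesgue_measure_itv/= lte_fin mul1e.
  by case: ltgtP x0 => // [_ _|<-//]; rewrite oppr0 adde0.
move=> y; rewrite inE/= in_itv/= => /andP[y0 yx].
by rewrite /uniform_pdf y0 (le_trans yx x1) subr0 invr1.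
Qed.

(** The bound concerns {Y < z}, the distribution function {Y <= x}. For 0 <= x < 1, {Y < x} inside
    {Y <= x} gives the lower estimate, and {Y <= x} inside {Y < z} with z > x the upper one; then
    squeeze. *)
Lemma cvg_in_law_uniform01 (R : realType) (d : nat -> measure_display)
    (T : forall n, measurableType (d n)) (P : forall n, probability (T n) R)
    (Y : forall n, T n -> R) (e : R ^nat) :
  (forall n, measurable_fun [set: T n] (Y n)) ->
  (forall n t, 0 <= Y n t < 1) ->
  (forall n z, 0 <= z -> z < 1 ->
    (`|P n [set t | (Y n t < z)%R] - z%:E| <= (e n)%:E)%E) ->
  e n @[n --> \oo] --> (0 : R) ->
  cvg_in_law P Y (@uniform01 R).
Proof.
move=> mY Y01 dist e0; split => // x _.
have [x0|x0] := ltP x 0.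
  rewrite uniform01_lt0//.
  rewrite (_ : (fun n => _) = cst 0%E); first exact: cvg_cst.
  apply/funext => n; rewrite (_ : _ @^-1` _ = set0) ?measure0//.
  apply/seteqP; split => // t /=; rewrite in_itv/= => Yx.
  have /andP[Y0 _] := Y01 n t.
  by move: x0; rewrite ltNge (le_trans Y0 Yx).
have [x1|x1] := leP 1 x.
  rewrite uniform01_ge1//.
  rewrite (_ : (fun n => _) = cst 1%E); first exact: cvg_cst.
  apply/funext => n; rewrite (_ : _ @^-1` _ = setT) ?probability_setT//.
  apply/seteqP; split => // t _ /=; rewrite in_itv/=.
  by have /andP[_ /ltW Y1] := Y01 n t; exact: le_trans x1.
rewrite uniform01_itv01 ?(ltW x1)//.
have mlt n z : measurable [set t | (Y n t < z)%R].
  by rewrite -[X in measurable X]setTI -preimage_itvNyo; exact: mY.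
have mle n : measurable (Y n @^-1` `]-oo, x]).
  by rewrite -[X in measurable X]setTI; exact: mY.
have fin n A : measurable A -> P n A \is a fin_num by exact: fin_num_measure.
have bound n z : 0 <= z -> z < 1 ->
    z - e n <= fine (P n [set t | (Y n t < z)%R]) <= z + e n.
  move=> z0 z1; have := dist n z z0 z1.
  by rewrite -(fineK (fin n _ (mlt n z))) -EFinB abse_EFin lee_fin ler_distl.
have lower n : x - e n <= fine (P n (Y n @^-1` `]-oo, x])).
  have /andP[lo _] := bound n x x0 x1; apply: le_trans lo _.
  apply: fine_le; rewrite ?fin//.
  apply: le_measure; rewrite ?inE//.
  by move=> t /= Yx; rewrite in_itv/= ltW.
have upper n : fine (P n (Y n @^-1` `]-oo, x])) <= x + e n.
  rewrite leNgt; apply/negP; set p := fine _ => px.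
  (* If p > x + e n, this [z] lies above [x] and below both [p - e n] and 1, so p <= P(Y < z) <= z +
     e n < p. *)
  pose z := Num.min ((x + (p - e n)) / 2) ((x + 1) / 2).
  have xz : x < z by rewrite lt_min; apply/andP; split; lra.
  have z1 : z < 1 by rewrite gt_min; apply/orP; right; lra.
  have zp : z < p - e n by rewrite gt_min; apply/orP; left; lra.
  have /andP[_ hi] := bound n z (le_trans x0 (ltW xz)) z1.
  suff : p <= fine (P n [set t | (Y n t < z)%R]) by lra.
  apply: fine_le; rewrite ?fin//.
  apply: le_measure; rewrite ?inE//.
  by move=> t /=; rewrite in_itv/= => Yx; exact: le_lt_trans xz.
apply/fine_cvgP; split; first by apply: nearW => n; exact/fin/mle.
apply: (@squeeze_cvgr _ _ _ _ (fun n => x - e n) (fun n => x + e n)).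
- by apply: nearW => n; rewrite /= lower upper.
- by rewrite -[X in _ --> X]subr0; apply: cvgB => //; exact: cvg_cst.
- by rewrite -[X in _ --> X]addr0; apply: cvgD => //; exact: cvg_cst.
Qed.

(** * The uniform bound and its limit form *)

Theorem theorem2 (R : realType) (I : interval R) (u : R -> R)
    (hC1 : C1_on I u)
    (hincr : {in I &, {homo u : x y / x < y}})
    (hu' : {in I, forall x, derive_in I u x != 0}) :
  (forall (d : measure_display) (T : measurableType d) (P : probability T R)
      (X : {RV P >-> R}) (f : R -> R) (m : R),
    (forall t, X t \in I) ->
    has_density_on X I f ->
    unimodal_with_max I (fun x => f x / derive_in I u x) m ->
    forall z : R, 0 <= z -> z < 1 ->
      (`|P [set t | (fracpart (u (X t)) < z)%R] - z%:E| < (2 * m)%:E)%E) /\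
  (forall (d : nat -> measure_display) (T : forall n, measurableType (d n))
      (P : forall n, probability (T n) R) (X : forall n, {RV (P n) >-> R})
      (f : nat -> R -> R) (m : nat -> R),
    (forall n t, X n t \in I) ->
    (forall n, has_density_on (X n) I (f n)) ->
    (forall n, unimodal_with_max I (fun x => f n x / derive_in I u x) (m n)) ->
    m n @[n --> \oo] --> (0 : R) ->
    cvg_in_law P (fun n t => fracpart (u (X n t))) (@uniform01 R)).
Proof.
have dist := prob_fracpart_lt hC1 hincr hu'.
split=> [d T P X f m|d T P X f m XI hf hg m0]; first exact: dist.
apply: (@cvg_in_law_uniform01 _ _ _ _ _ (fun n => 2 * m n)).
- by move=> n; exact: (measurable_fracpart_comp hC1).
- by move=> n t; rewrite fracpart_ge0 fracpart_lt1.
- by move=> n z z0 z1; apply/ltW/(dist _ _ _ _ (f n)).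
- by rewrite -(mulr0 2); apply: cvgM => //; exact: cvg_cst.
Qed.
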